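(* Let $X$ and $Y$ be real Hilbert spaces with $Y\neq\{0\}$, $\dim(Y)<\infty$ and $\dim(X)=\infty$. Then the real Cartan factor $L(X,Y)$ of all bounded linear operators from $X$ to $Y$, with the operator norm and the triple product $\{a,b,c\}=\frac12(ab^*c+cb^*a)$, is not ternary weakly amenable.
   Context: Here $b^*:Y\to X$ denotes the Hilbert space adjoint of $b$. Let $E$ be a real Jordan Banach triple. The dual $E^*$ is a real Jordan triple $E$-module with the products $\{a,b,\varphi\}(x)=\{\varphi,b,a\}(x):=\varphi(\{b,a,x\})$ and $\{a,\varphi,b\}(x):=\varphi(\{a,x,b\})$ for $a,b,x\in E$, $\varphi\in E^*$. A ternary derivation $\delta:E\to E^*$ is a linear map with $\delta\{a,b,c\}=\{\delta(a),b,c\}+\{a,\delta(b),c\}+\{a,b,\delta(c)\}$ for all $a,b,c\in E$. For $b\in E$, $\varphi\in E^*$, the map $\delta(b,\varphi)(a):=\{b,\varphi,a\}-\{\varphi,b,a\}$ is a ternary derivation $E\to E^*$; finite sums of such maps are called inner ternary derivations. $E$ is ternary weakly amenable if every continuous ternary derivation $E\to E^*$ is inner. *)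

(* Defs.v *)
From HB Require Import structures.
From mathcomp Require Import all_boot all_order all_algebra sesquilinear.
From mathcomp Require Import all_classical all_reals all_analysis.
From mathcomp Require Import ring lra.

Set Implicit Arguments.
Unset Strict Implicit.
Unset Printing Implicit Defensive.

Import Order.TTheory GRing.Theory Num.Theory.
Import numFieldNormedType.Exports.

Local Open Scope classical_set_scope.
Local Open Scope ring_scope.

Definition bounded_linear (R : realType) (V W : normedModType R) (f : V -> W) :=
  linear f /\ exists M : R, forall x, `|f x| <= M * `|x|.

Definition blin_pred (R : realType) (V W : normedModType R) :
  {pred (V -> W)} := [pred f | `[< bounded_linear f >]].

Record blin (R : realType) (V W : normedModType R) := Blin {
  blin_fun :> V -> W;
  _ : blin_fun \in @blin_pred R V W
}.

HB.instance Definition _ (R : realType) (V W : normedModType R) :=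
  [isSub for @blin_fun R V W].
HB.instance Definition _ (R : realType) (V W : normedModType R) :=
  [Choice of @blin R V W by <:].

Section blin_lmodule.
Context (R : realType) (V W : normedModType R).

Lemma blin_submod_closed : submod_closed (@blin_pred R V W).
Proof.
split.
  apply/asboolP; split; first by move=> k x y; change (0 = k *: 0 + 0 :> W); rewrite scaler0 addr0.
  by exists 0 => x; change (`|0 : W| <= 0 * `|x|); rewrite normr0 mul0r.
move=> k f g /asboolP[lf [M fM]] /asboolP[lg [N gN]]; apply/asboolP; split.
  move=> a x y; change (k *: f (a *: x + y) + g (a *: x + y) =
    a *: (k *: f x + g x) + (k *: f y + g y)).
  by rewrite lf lg !scalerDr !scalerA (mulrC a k) addrACA.
exists (`|k| * M + N) => x; change (`|k *: f x + g x| <= (`|k| * M + N) * `|x|).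
rewrite mulrDl.
rewrite (le_trans (ler_normD _ _))// lerD// normrZ -mulrA.
by rewrite ler_wpM2l.
Qed.

HB.instance Definition _ :=
  GRing.isSubmodClosed.Build R (V -> W) (@blin_pred R V W) blin_submod_closed.
HB.instance Definition _ :=
  [SubChoice_isSubLmodule of @blin R V W by <:].

Lemma blinP (f : blin V W) : bounded_linear f.
Proof. by case: f => f /= /asboolP. Qed.

HB.instance Definition _ (f : blin V W) :=
  GRing.isLinear.Build R V W _ (blin_fun f) (blinP f).1.

Lemma blin_ext (f g : blin V W) : (forall x, f x = g x) -> f = g.
Proof. by move=> fg; apply/val_inj/funext. Qed.

Lemma blinDE (f g : blin V W) x : (f + g) x = f x + g x. Proof. by []. Qed.
Lemma blinNE (f : blin V W) x : (- f) x = - f x. Proof. by []. Qed.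
Lemma blinBE (f g : blin V W) x : (f - g) x = f x - g x. Proof. by []. Qed.
Lemma blinZE k (f : blin V W) x : (k *: f) x = k *: f x. Proof. by []. Qed.
Lemma blin0E x : (0 : blin V W) x = 0. Proof. by []. Qed.

Definition mkblin (f : V -> W) (fP : bounded_linear f) : blin V W :=
  Blin (asboolT fP).

Definition opnorm (f : blin V W) : R :=
  sup [set `|f x| | x in [set x | `|x| <= 1]].

Lemma opnorm_has_sup (f : blin V W) :
  has_sup [set `|f x| | x in [set x | `|x| <= 1]].
Proof.
have [_ [M fM]] := blinP f.
split; first by exists `|f 0|, 0 => //=; rewrite normr0.
exists `|M| => _ [x /= x1 <-]; rewrite (le_trans (fM x))//.
rewrite (le_trans (ler_wpM2r _ (ler_norm M)))//.
by rewrite ler_piMr.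
Qed.

Lemma opnorm_ub (f : blin V W) x : `|f x| <= opnorm f * `|x|.
Proof.
have [->|x0] := eqVneq x 0; first by rewrite linear0 !normr0 mulr0.
have nx : 0 < `|x| by rewrite normr_gt0.
rewrite -ler_pdivrMr// -[X in _ * X]gtr0_norm ?invr_gt0// mulrC.
rewrite -normrZ -linearZ; apply: ub_le_sup; first exact: (opnorm_has_sup f).2.
by exists (`|x|^-1 *: x) => //=; rewrite normrZ gtr0_norm ?invr_gt0// mulVf// gt_eqF.
Qed.

Lemma opnorm_le (f : blin V W) (M : R) : 0 <= M ->
  (forall x, `|f x| <= M * `|x|) -> opnorm f <= M.
Proof.
move=> M0 fM; apply: ge_sup; first exact: (opnorm_has_sup f).1.
move=> _ [x /= x1 <-]; apply: (le_trans (fM x)).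
by rewrite ler_piMr.
Qed.

Lemma opnorm_ge0 (f : blin V W) : 0 <= opnorm f.
Proof.
rewrite (le_trans (normr_ge0 (f 0)))//; apply: ub_le_sup.
  exact: (opnorm_has_sup f).2.
by exists 0 => //=; rewrite normr0.
Qed.

Lemma opnormD (f g : blin V W) : opnorm (f + g) <= opnorm f + opnorm g.
Proof.
apply: opnorm_le => [|x]; first by rewrite addr_ge0 ?opnorm_ge0.
by rewrite blinDE mulrDl (le_trans (ler_normD _ _))// lerD ?opnorm_ub.
Qed.

Lemma opnormZ_le k (f : blin V W) : opnorm (k *: f) <= `|k| * opnorm f.
Proof.
apply: opnorm_le => [|x]; first by rewrite mulr_ge0 ?opnorm_ge0.
by rewrite blinZE normrZ -mulrA ler_wpM2l ?opnorm_ub.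
Qed.

Lemma opnormZ k (f : blin V W) : opnorm (k *: f) = `|k| * opnorm f.
Proof.
apply/eqP; rewrite eq_le opnormZ_le /=.
have [->|k0] := eqVneq k 0; first by rewrite normr0 mul0r opnorm_ge0.
rewrite -ler_pdivlMl ?normr_gt0// -normfV.
by rewrite -[in leLHS](scalerK k0 f) opnormZ_le.
Qed.

Lemma opnorm0_eq0 (f : blin V W) : opnorm f = 0 -> f = 0.
Proof.
move=> f0; apply: blin_ext => x; apply/eqP.
by rewrite -normr_le0 (le_trans (opnorm_ub f x))// f0 mul0r.
Qed.

HB.instance Definition _ :=
  Lmodule_isNormed.Build R (blin V W) opnormD opnormZ opnorm0_eq0.

Lemma blin_normE (f : blin V W) : `|f| = opnorm f. Proof. by []. Qed.

Lemma blin_le_norm (f : blin V W) x : `|f x| <= `|f| * `|x|.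
Proof. exact: opnorm_ub. Qed.

Lemma blin_norm_le (f : blin V W) (M : R) : 0 <= M ->
  (forall x, `|f x| <= M * `|x|) -> `|f| <= M.
Proof. exact: opnorm_le. Qed.

End blin_lmodule.

Arguments blin {R} V W.
Notation "''L(' V , W )" := (blin V W)
  (at level 0, format "''L(' V ,  W )") : type_scope.

Section blin_complete.
Context (R : realType) (V : normedModType R) (W : completeNormedModType R).

Lemma blin_cauchy_cvg (F : set_system (blin V W)) :
  ProperFilter F -> cauchy F -> cvg F.
Proof.
move=> FF /cauchy_ballP Fc.
have Fe (e : R) : 0 < e -> \forall f & h \near F, `|f - h| < e.
  by move=> e0; apply: filterS (Fc _ e0) => -[f h] /=; rewrite -ball_normE.
have cvx x : cvg ((fun f : blin V W => f x) @ F).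
  apply: cauchy_cvg; apply/cauchy_ballP => e e0.
  have d0 : 0 < e / (`|x| + 1) by rewrite divr_gt0// ltr_wpDl.
  have [[A B] /= [FA FB] AB] := Fe _ d0.
  exists ((fun f : blin V W => f x) @` A, (fun f : blin V W => f x) @` B) => /=.
    by split; [apply: filterS FA|apply: filterS FB] => f ?; exists f.
  move=> [_ _] /= [[f Af <-] [h Bh <-]]; rewrite -ball_normE /=.
  have := AB (f, h) (conj Af Bh) => /= fh.
  rewrite -blinBE (le_lt_trans (blin_le_norm _ _))//.
  rewrite (@le_lt_trans _ _ (`|f - h| * (`|x| + 1)))//.
    by rewrite ler_wpM2l// lerDl.
  by rewrite -ltr_pdivlMr// ltr_wpDl.
pose g x := lim ((fun f : blin V W => f x) @ F).
have gcvg x : (fun f : blin V W => f x) @ F --> g x by exact: cvx.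
have close (e : R) : 0 < e ->
      \forall f \near F, forall x, `|(f : blin V W) x - g x| <= e * `|x|.
  move=> e0; have [[A B] /= [FA FB] AB] := Fe _ e0.
  apply: filterS FA => f Af x.
  have : (fun h : blin V W => `|f x - h x|) @ F --> `|f x - g x|.
    by apply: cvg_norm; apply: cvgB => //; exact: cvg_cst.
  apply: (closed_cvg (fun r : R => r <= e * `|x|)).
    exact: closed_le.
  apply: filterS FB => h Bh; rewrite -blinBE (le_trans (blin_le_norm _ _))//.
  by rewrite ler_wpM2r// ltW// (AB (f, h)).
have glin : linear g.
  move=> k x y; apply: (@cvg_unique _ _ ((fun f : blin V W => f (k *: x + y)) @ F)) => //.
    exact: gcvg.
  rewrite (_ : (fun f : blin V W => f (k *: x + y)) = (fun f => k *: f x + f y)).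
    by apply: cvgD; [apply: cvgZr|]; exact: gcvg.
  by apply/funext => f; rewrite linearP.
have gbnd : exists M : R, forall x, `|g x| <= M * `|x|.
  have [f fg] := filter_ex (close _ ltr01).
  exists (`|f| + 1) => x; rewrite mulrDl.
  rewrite -[g x](subKr (f x)) (le_trans (ler_normB _ _))// lerD//.
  exact: blin_le_norm.
pose G : blin V W := mkblin (conj glin gbnd).
apply/cvg_ex; exists G; apply/cvgrPdist_le => e e0.
have := close _ e0; apply: filterS => f fg; rewrite distrC.
by apply: blin_norm_le; [exact: ltW|move=> x; rewrite blinBE].
Qed.

HB.instance Definition _ :=
  Uniform_isComplete.Build (blin V W) blin_cauchy_cvg.

End blin_complete.

Section blin_comp.
Context (R : realType) (U V W : normedModType R).

Lemma blin_comp_subproof (g : blin V W) (f : blin U V) :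
  bounded_linear (g \o f).
Proof.
split=> [k x y|] /=; first by rewrite !linearP.
exists (`|g| * `|f|) => x /=; rewrite (le_trans (blin_le_norm _ _))//.
by rewrite -mulrA ler_wpM2l// blin_le_norm.
Qed.

Definition blin_comp (g : blin V W) (f : blin U V) : blin U W :=
  mkblin (blin_comp_subproof g f).

Lemma blin_compE g f x : blin_comp g f x = g (f x). Proof. by []. Qed.

Lemma blin_comp_norm g f : `|blin_comp g f| <= `|g| * `|f|.
Proof.
apply: blin_norm_le => [|x]; first by rewrite mulr_ge0.
rewrite blin_compE (le_trans (blin_le_norm g _))//.
by rewrite -mulrA ler_wpM2l// blin_le_norm.
Qed.

End blin_comp.

HB.mixin Record CompleteNormedModule_isHilbert (R : realType) V
    of CompleteNormedModule R V := {
  dotp : {dot V for idfun};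
  dotpp : forall x : V, dotp x x = `|x| ^+ 2
}.

#[short(type="realHilbertType")]
HB.structure Definition RealHilbert (R : realType) :=
  {V of CompleteNormedModule R V & CompleteNormedModule_isHilbert R V}.

Section hilbert_theory.
Context (R : realType) (X : realHilbertType R).
Implicit Types x y z : X.

Lemma dotpC x y : dotp x y = dotp y x.
Proof. by rewrite (@hermitian_subproof _ _ _ _ dotp) /= expr0 mul1r. Qed.

Lemma dotpDr x y z : dotp x (y + z) = dotp x y + dotp x z.
Proof. by rewrite linearD. Qed.

Lemma dotpZr k x y : dotp x (k *: y) = k * dotp x y.
Proof. by rewrite linearZ. Qed.

Lemma dotpDl x y z : dotp (x + y) z = dotp x z + dotp y z.
Proof. by rewrite dotpC dotpDr !(dotpC z). Qed.

Lemma dotpZl k x y : dotp (k *: x) y = k * dotp x y.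
Proof. by rewrite dotpC dotpZr dotpC. Qed.

Lemma dotpNr x y : dotp x (- y) = - dotp x y.
Proof. by rewrite -scaleN1r dotpZr mulN1r. Qed.

Lemma dotpNl x y : dotp (- x) y = - dotp x y.
Proof. by rewrite -scaleN1r dotpZl mulN1r. Qed.

Lemma dotp_inj x y : (forall z, dotp x z = dotp y z) -> x = y.
Proof.
move=> xy; apply/eqP; rewrite -subr_eq0 -normr_eq0 -sqrf_eq0 -dotpp.
by rewrite dotpDl dotpNl xy subrr.
Qed.

Lemma dotp_CS x y : `|dotp x y| <= `|x| * `|y|.
Proof.
have [->|x0] := eqVneq x 0.
  by rewrite -(scale0r 0) dotpZl mul0r scale0r !normr0 mul0r.
have nx : 0 < `|x| ^+ 2 by rewrite exprn_gt0// normr_gt0.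
rewrite -ler_sqr ?nnegrE ?mulr_ge0// real_normK ?num_real//.
have : 0 <= dotp (y - (dotp x y / `|x| ^+ 2) *: x) (y - (dotp x y / `|x| ^+ 2) *: x).
  by rewrite dotpp exprn_ge0.
rewrite !(dotpDl, dotpDr, dotpNl, dotpNr, dotpZl, dotpZr) (dotpC y x) !dotpp.
set d := dotp x y; set a := `|x| ^+ 2 in nx *; set b := `|y| ^+ 2.
have -> : b + - (d / a * d) + (- (d / a * d) + - - (d / a * (d / a * a))) =
   b - d ^+ 2 / a.
  by field; rewrite gt_eqF.
by rewrite subr_ge0 ler_pdivrMr// exprMn -/a -/b mulrC.
Qed.

End hilbert_theory.

Lemma blinD (R : realType) (V W : normedModType R) (f : blin V W) x y :
  f (x + y) = f x + f y.
Proof. exact: linearD. Qed.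

Lemma blinZ (R : realType) (V W : normedModType R) (f : blin V W) k x :
  f (k *: x) = k *: f x.
Proof. exact: linearZ. Qed.

Lemma blin_continuous (R : realType) (V W : normedModType R) (f : blin V W) :
  continuous f.
Proof.
apply: bounded_linear_continuous; apply/linear_boundedP; near=> r => x.
rewrite (le_trans (blin_le_norm _ _))// ler_wpM2r//.
Unshelve. all: by end_near. Qed.

Section riesz.
Context (R : realType) (X : realHilbertType R) (f : blin X R^o).

Let J (x : X) : R := `|x| ^+ 2 - 2 * f x.
Let m := inf (range J).

Let fD x y : f (x + y) = f x + f y :> R. Proof. exact: linearD. Qed.
Let fZ k x : f (k *: x) = k * f x :> R. Proof. exact: linearZ. Qed.

Let J_lb x : m <= J x.
Proof.
apply: ge_inf; last by exists x.
exists (- `|f| ^+ 2) => _ [y _ <-]; rewrite /J.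
have : f y <= `|f| * `|y| by apply: le_trans (blin_le_norm _ _); exact: ler_norm.
have := sqr_ge0 (`|f| - `|y|).
by nra.
Qed.

Let J_adh (e : R) : 0 < e -> exists x, J x < m + e.
Proof.
move=> e0; have [|_ [x _ <-] Jx] := @inf_adherent _ (range J) e e0; last by exists x.
split; first by exists (J 0), 0.
by exists m => _ [x _ <-].
Qed.

Let J_parallelogram x y : `|x - y| ^+ 2 <= 2 * (J x - m) + 2 * (J y - m).
Proof.
have := J_lb (2^-1 *: (x + y)); rewrite /J fZ fD -!dotpp.
rewrite !(dotpDl, dotpDr, dotpNl, dotpNr, dotpZl, dotpZr) (dotpC y x) /=.
by lra.
Qed.

Let J_min : exists u, J u = m.
Proof.
have /choice[u uP] (n : nat) : exists x, J x < m + n.+1%:R^-1.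
  by apply: J_adh; rewrite invr_gt0.
have Ju_le (e : R) : 0 < e -> \forall n \near \oo, J (u n) <= m + e.
  move=> e0; have := near_infty_natSinv_lt (PosNum e0); apply: filterS => n /= ne.
  by rewrite (le_trans (ltW (uP n)))// lerD2l ltW.
have u_cvg : cvg (u @ \oo).
  apply: cauchy_cvg; apply/cauchy_exP => e e0.
  have d0 : 0 < e ^+ 2 / 8 by rewrite divr_gt0// exprn_gt0.
  have JN := Ju_le _ d0.
  have [N JuN] := filter_ex JN.
  exists (u N); change (\forall n \near \oo, ball (u N) e (u n)).
  apply: filterS JN => n Jun; rewrite -ball_normE /=.
  rewrite -ltr_sqr ?nnegrE ?(ltW e0)// (le_lt_trans (J_parallelogram _ _))//.
  have : 0 < e ^+ 2 by rewrite exprn_gt0.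
  by lra.
have [l ul] := (cvg_ex _).1 u_cvg.
exists l; apply/eqP; rewrite eq_le J_lb andbT; apply/ler_addgt0Pr => e e0.
have : (J \o u) n @[n --> \oo] --> J l.
  rewrite /J /=; apply: cvgB.
    by rewrite expr2; under eq_fun do rewrite expr2; apply: cvgM; apply: cvg_norm.
  apply: cvgM; first exact: cvg_cst.
  by apply: cvg_comp ul _; exact: blin_continuous.
apply: (closed_cvg (fun r : R => r <= m + e)); first exact: closed_le.
exact: Ju_le.
Qed.

Lemma riesz : exists u : X, forall v, f v = dotp u v.
Proof.
have [u Ju] := J_min; exists u => v.
set c := dotp u v - f v.
suff c0 : c = 0 by apply/esym/eqP; rewrite -subr_eq0 -/c c0.
set s := `|v| ^+ 2 + 1.
have s0 : 0 < s by rewrite ltr_wpDl// exprn_ge0.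
have s1 : 0 < s + 1 by rewrite addr_gt0.
have := J_lb (u + (- (c / s)) *: v); rewrite -Ju /J fD fZ -!dotpp.
rewrite !(dotpDl, dotpDr, dotpNl, dotpNr, dotpZl, dotpZr) (dotpC v u) /=.
rewrite -subr_ge0 !dotpp /=.
rewrite (_ : _ - _ = - (c ^+ 2 * (s + 1)) / s ^+ 2); last first.
  by rewrite /c /s; field; rewrite -/s gt_eqF.
rewrite pmulr_lge0 ?invr_gt0 ?exprn_gt0// oppr_ge0 pmulr_lle0//.
by move=> c2; apply/eqP; rewrite -sqrf_eq0 eq_le c2 sqr_ge0.
Qed.

End riesz.

Section adjoint.
Context (R : realType) (X Y : realHilbertType R).
Implicit Types b c : blin X Y.

Lemma adjoint_exists (b : blin X Y) :
  exists b' : blin Y X, forall x y, dotp (b x) y = dotp x (b' y).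
Proof.
have H y : exists u, forall x, dotp (b x) y = dotp x u.
  have bl : @bounded_linear R X R^o (fun x => dotp (b x) y).
    split=> [k x z|]; first by rewrite linearP dotpDl dotpZl.
    exists (`|b| * `|y|) => x; rewrite (le_trans (dotp_CS _ _))// mulrAC.
    by rewrite ler_wpM2r// blin_le_norm.
  have [u uP] := riesz (mkblin bl).
  by exists u => x; rewrite (dotpC x) -uP.
have [g gP] := choice H.
have gl : bounded_linear g.
  split=> [k x z|].
    by apply: dotp_inj => w; rewrite !(dotpC _ w) dotpDr dotpZr -!gP dotpDr dotpZr.
  exists `|b| => y.
  have [->|g0] := eqVneq (g y) 0; first by rewrite normr0 mulr_ge0.
  rewrite -(@ler_pM2r _ `|g y|) ?normr_gt0// -expr2 -dotpp -gP.
  rewrite (le_trans (ler_norm _))// (le_trans (dotp_CS _ _))// mulrAC.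
  by rewrite ler_wpM2r// blin_le_norm.
by exists (mkblin gl) => x y; rewrite gP.
Qed.

Definition adjoint (b : blin X Y) : blin Y X := sval (cid (adjoint_exists b)).

Lemma adjointP b x y : dotp (b x) y = dotp x (adjoint b y).
Proof. by rewrite /adjoint; case: cid. Qed.

Lemma adjointPl b x y : dotp (adjoint b y) x = dotp y (b x).
Proof. by rewrite dotpC -adjointP dotpC. Qed.

Lemma adjointP_linear k b c : adjoint (k *: b + c) = k *: adjoint b + adjoint c.
Proof.
apply: blin_ext => y; apply: dotp_inj => x.
rewrite adjointPl !blinDE !blinZE !(dotpDl, dotpZl, dotpDr, dotpZr).
by rewrite !adjointPl.
Qed.

Lemma adjoint_norm b : `|adjoint b| <= `|b|.
Proof.
apply: blin_norm_le => // y.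
have [->|g0] := eqVneq (adjoint b y) 0; first by rewrite normr0 mulr_ge0.
rewrite -(@ler_pM2r _ `|adjoint b y|) ?normr_gt0// -expr2 -dotpp -adjointP.
rewrite (le_trans (ler_norm _))// (le_trans (dotp_CS _ _))// mulrAC.
by rewrite ler_wpM2r// blin_le_norm.
Qed.

End adjoint.

(* The triple product is not required to be contractive: the definition only
   asks for continuity, here joint continuity on E * E * E. *)
HB.mixin Record CompleteNormedModule_isJordanTriple (R : realType) E
    of CompleteNormedModule R E := {
  tprod : E -> E -> E -> E;
  tprodC : forall a b c, tprod a b c = tprod c b a;
  tprod_linearl : forall b c, linear (fun a => tprod a b c);
  tprod_linearm : forall a c, linear (fun b => tprod a b c);
  tprod_jordan : forall a b x y z,
    tprod a b (tprod x y z) =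
    tprod (tprod a b x) y z - tprod x (tprod b a y) z + tprod x y (tprod a b z);
  tprod_continuous : continuous (fun p : E * E * E => tprod p.1.1 p.1.2 p.2)
}.

#[short(type="jordanBanachTripleType")]
HB.structure Definition JordanBanachTriple (R : realType) :=
  {E of CompleteNormedModule R E & CompleteNormedModule_isJordanTriple R E}.

Lemma trilinear_bounded_continuous (R : realType) (E : normedModType R)
    (T : E -> E -> E -> E) :
  (forall b c, linear (fun a => T a b c)) ->
  (forall a c, linear (fun b => T a b c)) ->
  (forall a b, linear (T a b)) ->
  (forall a b c, `|T a b c| <= `|a| * `|b| * `|c|) ->
  continuous (fun p : E * E * E => T p.1.1 p.1.2 p.2).
Proof.
move=> T1 T2 T3 Tb [[a0 b0] c0] /=.
have T1B b c x y : T (x - y) b c = T x b c - T y b c.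
  by rewrite addrC -scaleN1r T1 scaleN1r addrC.
have T2B a c x y : T a (x - y) c = T a x c - T a y c.
  by rewrite addrC -scaleN1r T2 scaleN1r addrC.
have T3B a b x y : T a b (x - y) = T a b x - T a b y.
  by rewrite addrC -scaleN1r T3 scaleN1r addrC.
apply/subr_cvg0; apply/norm_cvg0P.
have cvg1 : (fun p : E * E * E => p.1.1) @ (a0, b0, c0) --> a0.
  by apply: cvg_comp cvg_fst _; exact: cvg_fst.
have cvg2 : (fun p : E * E * E => p.1.2) @ (a0, b0, c0) --> b0.
  by apply: cvg_comp cvg_fst _; exact: cvg_snd.
have cvg3 : (fun p : E * E * E => p.2) @ (a0, b0, c0) --> c0 by exact: cvg_snd.
pose rhs (p : E * E * E) : R := `|p.1.1 - a0| * `|p.1.2| * `|p.2| +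
  `|a0| * `|p.1.2 - b0| * `|p.2| + `|a0| * `|b0| * `|p.2 - c0|.
apply: (@squeeze_cvgr _ _ _ _ (cst 0) rhs).
- near=> p; rewrite normr_ge0 /=.
  rewrite (_ : _ - _ = T (p.1.1 - a0) p.1.2 p.2 + T a0 (p.1.2 - b0) p.2 +
    T a0 b0 (p.2 - c0)).
    rewrite (le_trans (ler_normD _ _))// lerD//.
    by rewrite (le_trans (ler_normD _ _))// lerD.
  by rewrite T1B T2B T3B !addrA !subrK.
- exact: cvg_cst.
- have -> : 0 = `|a0 - a0| * `|b0| * `|c0| +
    `|a0| * `|b0 - b0| * `|c0| + `|a0| * `|b0| * `|c0 - c0|.
    by rewrite !subrr !normr0 !(mulr0, mul0r) !addr0.
  by apply: cvgD; [apply: cvgD|]; do 2?apply: cvgM;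
    try exact: cvg_cst; apply: cvg_norm => //; apply: cvgB => //; exact: cvg_cst.
Unshelve. all: by end_near. Qed.

Section L_triple.
Context (R : realType) (X Y : realHilbertType R).
Implicit Types a b c x y z : blin X Y.

Definition L_tprod a b c : blin X Y :=
  2^-1 *: (blin_comp (blin_comp a (adjoint b)) c +
           blin_comp (blin_comp c (adjoint b)) a).

Lemma L_tprodE a b c u :
  L_tprod a b c u = 2^-1 *: (a (adjoint b (c u)) + c (adjoint b (a u))).
Proof. by []. Qed.

Let L_tprodC a b c : L_tprod a b c = L_tprod c b a.
Proof. by rewrite /L_tprod addrC. Qed.

Let L_tprod_linearl b c : linear (fun a => L_tprod a b c).
Proof.
move=> k x y; apply: blin_ext => u; rewrite blinDE blinZE !L_tprodE.
rewrite !(blinDE, blinZE) !linearP !scalerDr !scalerA (mulrC k) -!addrA.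
by congr (_ + _); rewrite addrCA.
Qed.

Let L_tprod_linearm a c : linear (fun b => L_tprod a b c).
Proof.
move=> k x y; apply: blin_ext => u; rewrite blinDE blinZE !L_tprodE.
rewrite !adjointP_linear !(blinDE, blinZE) !linearP !scalerDr !scalerA (mulrC k).
by rewrite -!addrA; congr (_ + _); rewrite addrCA.
Qed.

Let L_tprod_jordan a b x y z :
  L_tprod a b (L_tprod x y z) =
  L_tprod (L_tprod a b x) y z - L_tprod x (L_tprod b a y) z +
  L_tprod x y (L_tprod a b z).
Proof.
apply: blin_ext => u; apply: dotp_inj => w.
rewrite blinDE blinBE !dotpDl dotpNl.
rewrite !L_tprodE !(dotpDl, dotpZl).
rewrite 2!(adjointP _ (adjoint (L_tprod b a y) _)) !(adjointPl (L_tprod b a y)).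
rewrite !L_tprodE.
rewrite !(dotpDl, dotpZl, dotpDr, dotpZr, adjointPl, adjointP).
rewrite !(blinZ, blinD, dotpDr, dotpZr) /=.
by field.
Qed.

Let L_tprod_norm a b c : `|L_tprod a b c| <= `|a| * `|b| * `|c|.
Proof.
rewrite /L_tprod normrZ ger0_norm ?invr_ge0// ler_pdivrMl//.
have H (p q : blin X Y) : `|blin_comp (blin_comp p (adjoint b)) q| <=
    `|p| * `|b| * `|q|.
  rewrite (le_trans (blin_comp_norm _ _))// ler_wpM2r//.
  rewrite (le_trans (blin_comp_norm _ _))// ler_wpM2l//.
  exact: adjoint_norm.
rewrite (le_trans (ler_normD _ _))// (le_trans (lerD (H a c) (H c a)))//.
by rewrite le_eqVlt; apply/orP; left; apply/eqP; ring.
Qed.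

Let L_tprod_continuous :
  continuous (fun p : blin X Y * blin X Y * blin X Y =>
    L_tprod p.1.1 p.1.2 p.2).
Proof.
apply: (trilinear_bounded_continuous L_tprod_linearl L_tprod_linearm) => //.
move=> a b k x y; rewrite !(L_tprodC a b).
exact: L_tprod_linearl.
Qed.

HB.instance Definition _ :=
  CompleteNormedModule_isJordanTriple.Build R (blin X Y)
    L_tprodC L_tprod_linearl L_tprod_linearm L_tprod_jordan L_tprod_continuous.

Lemma tprod_LE a b c :
  tprod a b c = 2^-1 *: (blin_comp (blin_comp a (adjoint b)) c +
                         blin_comp (blin_comp c (adjoint b)) a).
Proof. by []. Qed.

End L_triple.

Lemma continuous_linear_is_bounded (R : realType) (V W : normedModType R)
    (f : V -> W) : linear f -> continuous f -> bounded_linear f.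
Proof.
move=> fl fc; split=> //.
pose g : {linear V -> W} := HB.pack f (GRing.isLinear.Build R V W _ f fl).
have /linear_boundedP gb : bounded_near g (nbhs 0).
  by apply/linear_bounded_continuous.
by have [M Mb] := filter_ex gb; exists M.
Qed.

Section ternary_derivations.
Context (R : realType) (E : jordanBanachTripleType R).

Definition dual := 'L(E, R^o).

Implicit Types (a b c x : E) (phi : dual).

Lemma tprod_linearr a b : linear (tprod a b).
Proof. by move=> k x y; rewrite !(tprodC a b) tprod_linearl. Qed.

Lemma mod_outer_subproof phi b a :
  @bounded_linear R E R^o (fun x => phi (tprod b a x)).
Proof.
apply: continuous_linear_is_bounded => [k x y|x].
  by rewrite tprod_linearr linearP.
apply: (@continuous_comp _ _ _ (tprod b a) phi); last exact: blin_continuous.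
apply: (@continuous_comp _ _ _ (fun y => (b, a, y))
  (fun p : E * E * E => tprod p.1.1 p.1.2 p.2)); last exact: tprod_continuous.
apply: (@cvg_pair _ _ _ _ (nbhs (b, a)) (nbhs x)); [exact: cvg_cst|exact: cvg_id].
Qed.

Lemma mod_middle_subproof a phi b :
  @bounded_linear R E R^o (fun x => phi (tprod a x b)).
Proof.
apply: continuous_linear_is_bounded => [k x y|x].
  by rewrite tprod_linearm linearP.
apply: (@continuous_comp _ _ _ (fun y => tprod a y b) phi);
  last exact: blin_continuous.
apply: (@continuous_comp _ _ _ (fun y => (a, y, b))
  (fun p : E * E * E => tprod p.1.1 p.1.2 p.2)); last exact: tprod_continuous.
apply: (@cvg_pair _ _ _ _ (nbhs (a, x)) (nbhs b)); last exact: cvg_cst.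
by apply: (@cvg_pair _ _ _ _ (nbhs a) (nbhs x)); [exact: cvg_cst|exact: cvg_id].
Qed.

(* {phi, b, a}, which is also {a, b, phi}; below, {a, b, delta c} is therefore
   written mod_outer (delta c) b a. *)
Definition mod_outer phi b a : dual := mkblin (mod_outer_subproof phi b a).

(* {a, phi, b}. *)
Definition mod_middle a phi b : dual := mkblin (mod_middle_subproof a phi b).

Definition ternary_derivation (delta : {linear E -> dual}) :=
  forall a b c, delta (tprod a b c) =
    mod_outer (delta a) b c + mod_middle a (delta b) c +
    mod_outer (delta c) b a.

Definition inner_derivation b phi a : dual :=
  mod_middle b phi a - mod_outer phi b a.

Definition is_inner (delta : {linear E -> dual}) :=
  exists s : seq (E * dual),
    forall a, delta a = \sum_(p <- s) inner_derivation p.1 p.2 a.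

Definition ternary_weakly_amenable :=
  forall delta : {linear E -> dual},
    continuous delta -> ternary_derivation delta -> is_inner delta.

End ternary_derivations.

Definition finite_dimensional (R : realType) (V : lmodType R) :=
  exists (n : nat) (e : 'I_n -> V),
    forall v, exists c : 'I_n -> R, v = \sum_i c i *: e i.

(* Main.v *)
Require Import Defs.
From HB Require Import structures.
From mathcomp Require Import all_boot all_order all_algebra.
From mathcomp Require Import all_classical all_reals all_analysis.
From mathcomp Require Import ring lra.

Set Implicit Arguments.
Unset Strict Implicit.
Unset Printing Implicit Defensive.

Import Order.TTheory GRing.Theory Num.Theory.
Import numFieldNormedType.Exports.

Local Open Scope classical_set_scope.
Local Open Scope ring_scope.

(** Since [Y] is finite dimensional with orthonormal basis [f], every operator
on [Y] has a trace, and [(a, x) |-> trace (x a^* )] identifies [L(X, Y)] with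
its dual as a Jordan module.  Under this identification every bounded
skew-adjoint [B] on [X] yields a ternary derivation
[delta a x = trace (x B a^* )], that is, [a |-> - a B] (lemma
[skew_derivation]): the defining identity follows from cyclicity of the trace
and from its invariance under adjoints.

The derivation can only be inner if [B] has finite rank.  Restrict a derivation
to operators of rank one with a common range vector [y]: [delta] becomes the
bilinear form [(u, v) |-> |y|^2 <v, B u>] on [X], while
[inner_derivation b phi] becomes, up to a scalar,
[phi (b v (x) u) - phi (b u (x) v)] (lemma [inner_derivation_rank1]).  The
latter form vanishes for all [v] as soon as finitely many linear conditions on
[u] hold, namely [b u = 0] and [phi (f i (x) u) = 0] for every [i]
(lemma [inner_finite_rank]); the same is then true of finite sums.

An infinite dimensional [X] contains an orthonormal sequence [e], and the
norm-convergent series [B = sum_n 2^-n e_2n /\ e_2n+1] is skew-adjoint with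
infinite rank (lemmas [skew_diagonal] and [diagonal_not_finite_rank]), so its
derivation is not inner. *)

(** * Orthonormal families *)

Section orthonormal_family.
Context (R : realType) (X : realHilbertType R).
Implicit Types (u v w : X) (s : seq X).

Lemma dotp0r u : dotp u 0 = 0.
Proof. exact: linear0. Qed.

Lemma dotp_sumr I (r : seq I) (P : pred I) (F : I -> X) u :
  dotp u (\sum_(i <- r | P i) F i) = \sum_(i <- r | P i) dotp u (F i).
Proof. exact: linear_sum. Qed.

Definition orthonormal_family (I : eqType) (e : I -> X) :=
  forall i j, dotp (e i) (e j) = (i == j)%:R.

Lemma orthonormal_norm (I : eqType) (e : I -> X) i :
  orthonormal_family e -> `|e i| = 1.
Proof.
move=> oe; have := oe i i; rewrite eqxx dotpp => e1.
by apply/eqP; rewrite -(@eqrXn2 _ 2)// e1 expr1n.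
Qed.

Lemma dotp_orthonormal (I : finType) (e : I -> X) (w : I -> R) j :
  orthonormal_family e -> dotp (e j) (\sum_i w i *: e i) = w j.
Proof.
move=> oe; rewrite dotp_sumr (bigD1 j)//= dotpZr oe eqxx mulr1.
rewrite big1 ?addr0// => i ij.
by rewrite dotpZr oe eq_sym (negbTE ij) mulr0.
Qed.

Definition orthonormal_basis n (f : 'I_n -> X) :=
  orthonormal_family f /\ forall v, v = \sum_i dotp (f i) v *: f i.

(** Finite families are handled as sequences so that they can grow. *)
Let fam s (i : 'I_(size s)) := s`_i.
Let on s := orthonormal_family (fam (s := s)).

(** Gram-Schmidt step: normalize what an expansion of [v] along [s] leaves. *)
Let on_rcons s : on s -> ~ orthonormal_basis (fam (s := s)) ->
  exists u, on (rcons s u).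
Proof.
move=> os nb; have [v vP] : exists v, v != \sum_i dotp (fam i) v *: fam (s := s) i.
  apply: contrapT => /forallNP nv; apply: nb; split => // v.
  by apply/eqP/negPn/negP; exact: nv.
pose r := v - \sum_i dotp (fam i) v *: fam (s := s) i.
have r0 : `|r| != 0 by rewrite normr_eq0 subr_eq0.
have or_ i : dotp (fam (s := s) i) r = 0.
  by rewrite dotpDr dotpNr dotp_orthonormal// subrr.
pose u := `|r|^-1 *: r.
have ou i : (i < size s)%N -> dotp s`_i u = 0.
  by move=> si; rewrite dotpZr (or_ (Ordinal si)) mulr0.
have uu : dotp u u = 1.
  by rewrite dotpZr dotpZl dotpp expr2 mulKf// mulVf.
exists u => i j; rewrite -[i == j]val_eqE /fam; case: i j => [i +] [j +] /=.
rewrite size_rcons !ltnS !nth_rcons.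
rewrite leq_eqVlt => /orP[/eqP-> | si];
  rewrite leq_eqVlt => /orP[/eqP-> | sj].
- by rewrite !ltnn !eqxx uu.
- by rewrite sj ltnn eqxx dotpC ou// gtn_eqF.
- by rewrite si ltnn eqxx ou// ltn_eqF.
- by rewrite si sj; exact: (os (Ordinal si) (Ordinal sj)).
Qed.

(** Either the iteration of the Gram-Schmidt step stops at a basis, or it never
stops and its successive finite families are the prefixes of a sequence. *)
Lemma orthonormal_basis_or_sequence :
  (exists n (f : 'I_n -> X), orthonormal_basis f) \/
  (exists e : nat -> X, orthonormal_family e).
Proof.
have [?|nb] := pselect (exists n (f : 'I_n -> X), orthonormal_basis f); first by left.
right; have /choice[next nextP] s : exists u, on s -> on (rcons s u).
  have [os|nos] := pselect (on s); last by exists 0.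
  have [|u uP] := on_rcons os; last by exists u.
  by move=> b; apply: nb; exists (size s), (fam (s := s)).
pose L n := iter n (fun s => rcons s (next s)) [::].
have onL n : on (L n) by elim: n => [[]//|n ih]; exact: nextP.
have sL n : size (L n) = n by elim: n => //= n ih; rewrite size_rcons ih.
pose e n := next (L n).
have Le n i : (i < n)%N -> (L n)`_i = e i.
  elim: n => // n ih; rewrite ltnS leq_eqVlt /= nth_rcons sL.
  by move=> /orP[/eqP->|i_n]; rewrite ?ltnn ?eqxx// i_n ih.
exists e => i j; pose n := (maxn i j).+1.
have iL : (i < size (L n))%N by rewrite sL ltnS leq_maxl.
have jL : (j < size (L n))%N by rewrite sL ltnS leq_maxr.
have : dotp (L n)`_i (L n)`_j = (i == j)%:R := onL n (Ordinal iL) (Ordinal jL).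
by rewrite (Le n i) ?(Le n j)// ltnS ?leq_maxl ?leq_maxr.
Qed.

Lemma left_kernel_neq0 n (A : 'M[R]_(n.+1, n)) :
  exists2 w : 'rV_n.+1, w != 0 & w *m A = 0.
Proof.
have : kermx A != 0.
  by rewrite kermx_eq0 /row_free neq_ltn ltnS rank_leq_col.
by move=> /rowV0Pn[w /sub_kermxP wA w0]; exists w.
Qed.

(** If [n] vectors span, the coefficients of [e 0, ..., e n] on them form a
matrix with more rows than columns; a vector in its left kernel is a nontrivial
linear relation between orthonormal vectors. *)
Lemma orthonormal_not_finite_dimensional (e : nat -> X) :
  orthonormal_family e -> ~ finite_dimensional X.
Proof.
move=> oe [n [f fP]].
have /choice[c cP] i := fP (e i).
have [w w0 wc] := left_kernel_neq0 (\matrix_(i < n.+1, j < n) c i j).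
case/negP: w0; apply/eqP/rowP => i; rewrite mxE.
have oe' : orthonormal_family (fun i : 'I_n.+1 => e i) by move=> j k; rewrite oe.
rewrite -(dotp_orthonormal (w 0) i oe').
under eq_bigr => j _ do rewrite cP scaler_sumr.
rewrite exchange_big big1 ?dotp0r// => k _ /=.
under eq_bigr => j _ do rewrite scalerA.
rewrite -scaler_suml; move/rowP: wc => /(_ k); rewrite !mxE.
by under eq_bigr => j _ do rewrite mxE; move=> ->; rewrite scale0r.
Qed.

Lemma orthonormal_basis_exists :
  finite_dimensional X -> exists n (f : 'I_n -> X), orthonormal_basis f.
Proof.
move=> fd; have [//|[e /orthonormal_not_finite_dimensional//]] :=
  orthonormal_basis_or_sequence.
Qed.

Lemma orthonormal_sequence_exists :
  ~ finite_dimensional X -> exists e : nat -> X, orthonormal_family e.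
Proof.
move=> nfd; have [[n [f [_ fP]]]|//] := orthonormal_basis_or_sequence.
by case: nfd; exists n, f => v; exists (fun i => dotp (f i) v).
Qed.

End orthonormal_family.

(** * Operators of rank one *)

Lemma blin_sumE (R : realType) (V W : normedModType R) I (r : seq I)
    (F : I -> 'L(V, W)) x :
  (\sum_(i <- r) F i) x = \sum_(i <- r) F i x.
Proof. by elim/big_ind2: _ => // a a' b b' <- <-. Qed.

Section rank1.
Context (R : realType) (X Y : realHilbertType R).

Lemma rank1_subproof (y : Y) (u : X) : bounded_linear (fun w : X => dotp u w *: y).
Proof.
split=> [k a b|]; first by rewrite dotpDr dotpZr scalerDl scalerA.
exists (`|y| * `|u|) => w; rewrite normrZ mulrC -mulrA ler_wpM2l//; exact: dotp_CS.
Qed.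

Definition rank1 (y : Y) (u : X) : 'L(X, Y) := mkblin (rank1_subproof y u).

Lemma rank1E y u w : rank1 y u w = dotp u w *: y.
Proof. by []. Qed.

Lemma rank1_norm y u : `|rank1 y u| <= `|y| * `|u|.
Proof.
apply: blin_norm_le => [|w]; first by rewrite mulr_ge0.
rewrite rank1E normrZ mulrC -mulrA ler_wpM2l//; exact: dotp_CS.
Qed.

Lemma rank1_linearr y : linear (rank1 y).
Proof.
move=> k u v; apply: blin_ext => w; rewrite blinDE blinZE !rank1E.
by rewrite dotpDl dotpZl scalerDl scalerA.
Qed.

Lemma adjoint_rank1 y u z : adjoint (rank1 y u) z = dotp y z *: u.
Proof.
apply: dotp_inj => w; rewrite adjointPl rank1E dotpZr dotpZl mulrC.
by congr (_ * _); rewrite dotpC.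
Qed.

Lemma rank1_basis n (f : 'I_n -> Y) y u : orthonormal_basis f ->
  rank1 y u = \sum_i dotp (f i) y *: rank1 (f i) u.
Proof.
move=> [_ fP]; apply: blin_ext => w; rewrite rank1E [in LHS](fP y) scaler_sumr.
rewrite blin_sumE; apply: eq_bigr => i _.
by rewrite blinZE rank1E scalerA scalerA mulrC.
Qed.

End rank1.

(** * Skew-adjoint operators of infinite rank *)

Section skew.
Context (R : realType) (X : realHilbertType R).

Definition wedge (a b : X) : 'L(X, X) := rank1 b a - rank1 a b.

Lemma wedge_norm a b : `|wedge a b| <= 2 * (`|a| * `|b|).
Proof.
rewrite (le_trans (ler_normB _ _))// mulr2n mulrDl mul1r lerD//.
  by rewrite mulrC rank1_norm.
exact: rank1_norm.
Qed.

Lemma matrix_coef_subproof (u v : X) :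
  bounded_linear (fun A : 'L(X, X) => dotp v (A u) : R^o).
Proof.
split=> [k A C|]; first by rewrite dotpDr dotpZr.
exists (`|v| * `|u|) => A; rewrite (le_trans (dotp_CS _ _))//.
by rewrite -mulrA ler_wpM2l// mulrC blin_le_norm.
Qed.

(** The coefficient [<v, A u>] as a continuous functional of the operator [A],
through which identities between coefficients pass to limits of operators. *)
Definition matrix_coef u v : 'L('L(X, X), R^o) := mkblin (matrix_coef_subproof u v).

Definition skew_adjoint (B : 'L(X, X)) := forall u v, dotp u (B v) = - dotp v (B u).

Lemma matrix_coef_wedge k a b u v :
  matrix_coef u v (k *: wedge a b) = k * (dotp a u * dotp b v - dotp b u * dotp a v).
Proof.
change (dotp v ((k *: wedge a b) u) =
  k * (dotp a u * dotp b v - dotp b u * dotp a v)).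
by rewrite blinZE dotpZr blinBE !rank1E dotpDr dotpNr !dotpZr !(dotpC v).
Qed.

(** The weights [2^-n] make the series [sum_n 2^-n e_2n /\ e_2n+1] converge
absolutely in operator norm; the even-odd block of its limit is diagonal with
nonzero entries, which gives infinite rank. *)
Lemma skew_diagonal (e : nat -> X) : orthonormal_family e ->
  exists2 B : 'L(X, X), skew_adjoint B &
    forall p q, dotp (e q.*2.+1) (B (e p.*2)) = (p == q)%:R * 2^-1 ^+ p.
Proof.
move=> oe; pose t n : 'L(X, X) := 2^-1 ^+ n *: wedge (e n.*2) (e n.*2.+1).
have tcvg : cvgn (series t).
  apply: normed_cvg.
  apply: (@series_le_cvg _ _ (geometric 2 2^-1)) => //.
  - by move=> n /=; exact: normr_ge0.
  - by move=> n /=; rewrite mulr_ge0// exprn_ge0// invr_ge0.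
  - move=> n; rewrite /t /= normrZ ger0_norm ?exprn_ge0 ?invr_ge0// mulrC.
    rewrite ler_wpM2r ?exprn_ge0 ?invr_ge0//.
    by rewrite (le_trans (wedge_norm _ _))// !orthonormal_norm// !mulr1.
  - apply: is_cvg_geometric_series.
    by rewrite ger0_norm ?invr_ge0// invf_lt1// ltr1n.
have [B tB] := (cvg_ex _).1 tcvg; exists B.
  move=> u v.
  (* Skew-adjointness is obtained by polarization of [<x, B x> = 0]. *)
  have zu x : dotp x (B x) = 0.
    have : (matrix_coef x x \o series t) n @[n --> \oo] --> matrix_coef x x B.
      by apply: cvg_comp tB _; exact: blin_continuous.
    apply: (closed_cvg (fun r : R => r = 0)); first exact: closed_eq.
    apply: nearW => n; rewrite [LHS](linear_sum (matrix_coef x x)) big1// => i _.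
    apply: etrans (matrix_coef_wedge _ _ _ _ _) _.
    by rewrite mulrC [X in _ - X]mulrC subrr mul0r.
  have := zu (u + v); rewrite linearD !(dotpDl, dotpDr) !zu; lra.
move=> p q.
have : (matrix_coef (e p.*2) (e q.*2.+1) \o series t) n @[n --> \oo] -->
    matrix_coef (e p.*2) (e q.*2.+1) B.
  by apply: cvg_comp tB _; exact: blin_continuous.
apply: (closed_cvg (fun r : R => r = (p == q)%:R * 2^-1 ^+ p)).
  exact: closed_eq.
(* From index p.+1 on, the coefficient of the partial sum is constant. *)
exists p.+1 => // n /= pn.
rewrite [LHS](linear_sum (matrix_coef (e p.*2) (e q.*2.+1))) big_mkord.
have tE k : matrix_coef (e p.*2) (e q.*2.+1) (t k) =
    2^-1 ^+ k * ((k == p)%:R * (k == q)%:R).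
  apply: etrans (matrix_coef_wedge _ _ _ _ _) _; rewrite !oe eqSS !(inj_eq double_inj).
  rewrite [k.*2 == q.*2.+1](_ : _ = false) ?mulr0 ?subr0//.
  by apply/negP => /eqP /(congr1 odd); rewrite /= !odd_double.
rewrite (eq_bigr _ (fun k _ => tE (val k))) (bigD1 (Ordinal pn))//=.
rewrite eqxx mul1r mulrC big1 ?addr0// => k kp.
by rewrite -val_eqE /= in kp; rewrite (negbTE kp) mul0r mulr0.
Qed.

End skew.

(** * Bilinear forms of finite rank *)

Section finite_rank.
Context (R : realType) (X : realHilbertType R).
Implicit Types (G : X -> X -> R).

(** For a bilinear form, this says that the left kernel has finite codimension;
the linear map [g] packs finitely many functionals that cut out a subspace of
this kernel. *)
Definition finite_rank G := exists n (g : X -> 'rV[R]_n),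
  linear g /\ forall u, g u = 0 -> forall v, G u v = 0.

Lemma finite_rank_sum T (s : seq T) (G : T -> X -> X -> R) :
  (forall t, finite_rank (G t)) ->
  finite_rank (fun u v => \sum_(t <- s) G t u v).
Proof.
move=> Gfr; elim: s => [|t s [n [g [gl gP]]]].
  exists 0%N, (fun=> 0); split=> [k u v|u _ v]; first by rewrite scaler0 addr0.
  by rewrite big_nil.
have [m [h [hl hP]]] := Gfr t.
exists (m + n)%N, (fun u => row_mx (h u) (g u)); split=> [k u v|u].
  by rewrite hl gl scale_row_mx add_row_mx.
rewrite -[RHS]row_mx0 => /eq_row_mx[hu gu] v.
by rewrite big_cons hP// gP// addr0.
Qed.

(** Among [n.+1] of the vectors [a p], some nontrivial combination [u] satisfies
the [n] conditions [g u = 0]; but pairing [B u] with [c q] recovers the [q]-th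
coordinate of [u] up to the nonzero factor [l q]. *)
Lemma diagonal_not_finite_rank (B : 'L(X, X)) (a c : nat -> X) (l : nat -> R) :
  (forall p, l p != 0) ->
  (forall p q, dotp (c q) (B (a p)) = (p == q)%:R * l p) ->
  ~ finite_rank (fun u v => dotp v (B u)).
Proof.
move=> l0 Bac [n [g [gl gP]]].
have [w w0 wA] := left_kernel_neq0 (\matrix_(p < n.+1) g (a p)).
case/negP: w0; apply/eqP/rowP => q; rewrite mxE.
pose glin : {linear X -> 'rV[R]_n} := HB.pack g (GRing.isLinear.Build R X _ _ g gl).
have gu : glin (\sum_(p < n.+1) w 0 p *: a p) = 0.
  rewrite linear_sum -[RHS]wA mulmx_sum_row; apply: eq_bigr => p _.
  by rewrite linearZ rowK.
have := gP _ gu (c q); rewrite linear_sum dotp_sumr (bigD1 q)//= linearZ dotpZr Bac.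
rewrite eqxx mul1r big1 ?addr0 => [/eqP|p pq].
  by rewrite mulf_eq0 (negbTE (l0 _)) orbF => /eqP.
by rewrite linearZ dotpZr Bac [(_ == _ :> nat)](negbTE pq) mul0r mulr0.
Qed.

End finite_rank.

(** * Inner derivations on operators of rank one *)

Section inner.
Context (R : realType) (X Y : realHilbertType R).
Implicit Types (b : 'L(X, Y)) (phi : dual 'L(X, Y)) (y : Y) (u v : X).

(** Write [a = y (x) u] and [x = y (x) v].  In [{b, x, a} - {b, a, x}] the
products [a x^* b] and [x a^* b] are both [<u, v>] times [y (x) (b^* y)] and
cancel; what remains are the terms in which [b] acts on [u] or [v]. *)
Lemma inner_derivation_rank1 b phi y u v :
  inner_derivation b phi (rank1 y u) (rank1 y v) =
  2^-1 * dotp y y * (phi (rank1 (b v) u) - phi (rank1 (b u) v)).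
Proof.
have tE : L_tprod b (rank1 y v) (rank1 y u) =
    L_tprod b (rank1 y u) (rank1 y v) +
    (2^-1 * dotp y y) *: (rank1 (b v) u - rank1 (b u) v).
  apply: blin_ext => w; rewrite blinDE !L_tprodE blinZE blinBE !rank1E.
  rewrite !adjoint_rank1 !blinZ !dotpZr (dotpC v u).
  rewrite (mulrC (dotp u w)) (mulrC (dotp v w)) scalerBr !scalerDr !scalerA !mulrA.
  by rewrite [RHS]addrC addrA subrK.
change (phi (L_tprod b (rank1 y v) (rank1 y u)) -
  phi (L_tprod b (rank1 y u) (rank1 y v)) =
  2^-1 * dotp y y * (phi (rank1 (b v) u) - phi (rank1 (b u) v))).
by rewrite tE linearD addrC addKr linearZ linearB.
Qed.

(** If [b u = 0], only [phi (b v (x) u)] remains; expanding [b v] on the finite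
basis of [Y] reduces its vanishing for all [v] to finitely many conditions
on [u]. *)
Lemma inner_finite_rank n (f : 'I_n -> Y) b phi : orthonormal_basis f ->
  finite_rank (fun u v => phi (rank1 (b v) u) - phi (rank1 (b u) v)).
Proof.
move=> fb.
exists (n + n)%N, (fun u =>
  row_mx (\row_i phi (rank1 (f i) u)) (\row_i dotp (f i) (b u))).
split=> [k u v|u].
  rewrite scale_row_mx add_row_mx; congr row_mx; apply/rowP => i; rewrite !mxE.
    by rewrite rank1_linearr linearP.
  by rewrite linearP dotpDr dotpZr.
rewrite -[RHS]row_mx0 => /eq_row_mx[/rowP phiu /rowP bu] v.
have -> : b u = 0.
  rewrite (fb.2 (b u)) big1// => i _.
  by have := bu i; rewrite !mxE => ->; rewrite scale0r.
rewrite (_ : rank1 0 v = 0); last by apply: blin_ext => w; rewrite rank1E scaler0.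
rewrite linear0 subr0 (rank1_basis _ _ fb) linear_sum big1// => i _.
have phi0 : phi (rank1 (f i) u) = 0 by have := phiu i; rewrite !mxE.
by apply: etrans (blinZ phi _ _) _; rewrite phi0 scaler0.
Qed.

End inner.

(** * The derivation of a skew-adjoint operator *)

Section trace.
Context (R : realType) (X Y : realHilbertType R).
Context (n : nat) (f : 'I_n -> Y) (fb : orthonormal_basis f).
Implicit Types (a b c x : 'L(X, Y)) (P Q : 'L(Y, Y)).

Lemma parseval y z : dotp y z = \sum_i dotp (f i) y * dotp (f i) z.
Proof.
rewrite [z in LHS](fb.2 z) dotp_sumr; apply: eq_bigr => i _.
by rewrite dotpZr mulrC (dotpC y).
Qed.

Definition trace P : R := \sum_i dotp (f i) (P (f i)).

Lemma trace_comp P Q : trace (blin_comp P Q) = trace (blin_comp Q P).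
Proof.
rewrite /trace; under eq_bigr => i _ do rewrite blin_compE -adjointPl parseval.
under [RHS]eq_bigr => i _ do rewrite blin_compE -adjointPl parseval.
rewrite exchange_big; apply: eq_bigr => i _; apply: eq_bigr => j _.
by rewrite -!adjointP mulrC !(dotpC _ (f _)).
Qed.

Lemma trace_adjoint P : trace (adjoint P) = trace P.
Proof. by apply: eq_bigr => i _; rewrite -adjointP dotpC. Qed.

Lemma adjoint_comp P Q :
  adjoint (blin_comp P Q) = blin_comp (adjoint Q) (adjoint P).
Proof.
apply: blin_ext => y; apply: dotp_inj => z.
by rewrite adjointPl !blin_compE !adjointPl.
Qed.

Lemma adjoint_tprod a b c y : adjoint (L_tprod a b c) y =
  2^-1 *: (adjoint c (b (adjoint a y)) + adjoint a (b (adjoint c y))).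
Proof.
apply: dotp_inj => z; rewrite adjointPl L_tprodE dotpZr dotpZl dotpDr dotpDl.
by rewrite !adjointPl !(adjointP b) !adjointPl.
Qed.

Variables (B : 'L(X, X)) (Bskew : skew_adjoint B).

Let W x a : 'L(Y, Y) := blin_comp x (blin_comp B (adjoint a)).
Let D a b : 'L(Y, Y) := blin_comp a (adjoint b).

Let adjointD a b : adjoint (D a b) = D b a.
Proof.
apply: blin_ext => y; apply: dotp_inj => z.
by rewrite adjointPl !blin_compE (adjointP b) adjointPl.
Qed.

Let adjointW x a : adjoint (W x a) = - W a x.
Proof.
apply: blin_ext => y; apply: dotp_inj => z.
rewrite blinNE dotpNl adjointPl !blin_compE (adjointP a) (dotpC (B _)).
by rewrite Bskew opprK adjointPl.
Qed.

(** Transposing turns [tr (x c^* b B a^* )] into minus [tr (a B b^* c x^* )]: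
this sign makes the four terms of the derivation identity without a counterpart on
the left-hand side cancel in pairs. *)
Let trace_DW x c b a : trace (blin_comp (D x c) (W b a)) =
  - trace (blin_comp (D c x) (W a b)).
Proof.
rewrite -trace_adjoint adjoint_comp adjointD adjointW trace_comp /trace -sumrN.
apply: eq_bigr => i _.
by rewrite !(blin_compE (D c x)) blinNE (linearN (D c x)) dotpNr.
Qed.

Let F a x := trace (W x a).

Let F_tprodl a b c x : F (L_tprod a b c) x =
  2^-1 * (trace (blin_comp (W x c) (D b a)) + trace (blin_comp (W x a) (D b c))).
Proof.
rewrite /F /trace -big_split mulr_sumr; apply: eq_bigr => i _ /=.
by rewrite adjoint_tprod !(linearZ, linearD).
Qed.

Let F_tprodr a b c x : F a (L_tprod b c x) =
  2^-1 * (trace (blin_comp (D b c) (W x a)) + trace (blin_comp (D x c) (W b a))).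
Proof.
rewrite /F /trace -big_split mulr_sumr; apply: eq_bigr => i _ /=.
by rewrite dotpZr dotpDr.
Qed.

Let F_derivation a b c x : F (L_tprod a b c) x =
  F a (L_tprod b c x) + F b (L_tprod a x c) + F c (L_tprod b a x).
Proof.
rewrite F_tprodl !F_tprodr !(trace_comp (W _ _)).
rewrite (trace_DW x c) (trace_DW x a); ring.
Qed.

Let F_bound a x : `|F a x| <= n%:R * `|B| * `|a| * `|x|.
Proof.
have fi i : `|f i| = 1 := orthonormal_norm i fb.1.
rewrite (le_trans (ler_norm_sum _ _ _))//.
rewrite -[n in leRHS]card_ord -sum1_card natr_sum !mulr_suml; apply: ler_sum => i _.
rewrite mul1r (le_trans (dotp_CS _ _))// fi mul1r.
rewrite (le_trans (blin_le_norm x _))// mulrC ler_wpM2r//.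
rewrite (le_trans (blin_le_norm B _))// ler_wpM2l//.
by rewrite (le_trans (blin_le_norm _ _))// fi mulr1 adjoint_norm.
Qed.

Let delta_subproof a : @bounded_linear R 'L(X, Y) R^o (F a).
Proof.
split=> [k x z|]; last by exists (n%:R * `|B| * `|a|); exact: F_bound.
rewrite /F /trace scaler_sumr -big_split; apply: eq_bigr => i _ /=.
set q := B _; by rewrite [LHS](dotpDr _ (k *: x q) (z q)) dotpZr.
Qed.

Let delta a : dual 'L(X, Y) := mkblin (delta_subproof a).

Let delta_bounded_linear : bounded_linear delta.
Proof.
split=> [k a c|].
  apply: blin_ext => x; rewrite blinDE blinZE /= /F /trace.
  rewrite scaler_sumr -big_split; apply: eq_bigr => i _ /=.
  by rewrite adjointP_linear blinDE blinZE !(blinD, blinZ) dotpDr dotpZr.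
exists (n%:R * `|B|) => a; apply: blin_norm_le => [|x]; last exact: F_bound.
by rewrite !mulr_ge0.
Qed.

(** The values on operators of rank one are recorded because they recover [B];
Parseval's identity for [y] collapses the trace there. *)
Lemma skew_derivation : exists delta : {linear 'L(X, Y) -> dual 'L(X, Y)},
  [/\ continuous delta, ternary_derivation delta &
      forall y u v, delta (rank1 y u) (rank1 y v) = dotp y y * dotp v (B u)].
Proof.
exists (mkblin delta_bounded_linear : {linear _ -> _}); split.
- exact: blin_continuous.
- move=> a b c; apply: blin_ext => x; exact: F_derivation.
- move=> y u v; change (F (rank1 y u) (rank1 y v) = dotp y y * dotp v (B u)).
  rewrite (parseval y y) mulr_suml; apply: eq_bigr => i _.
  by rewrite /W !blin_compE adjoint_rank1 rank1E blinZ !dotpZr (dotpC y); ring.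
Qed.

End trace.

Theorem theorem5p6 (R : realType) (X Y : realHilbertType R)
    (Y_neq0 : exists y : Y, y != 0)
    (Y_fin : finite_dimensional Y)
    (X_inf : ~ finite_dimensional X) :
  ~ ternary_weakly_amenable 'L(X, Y).
Proof.
move=> wa; have [y y0] := Y_neq0.
have [n [f fb]] := orthonormal_basis_exists Y_fin.
have [e oe] := orthonormal_sequence_exists X_inf.
have [B Bskew Be] := skew_diagonal oe.
have [delta [dc dd dB]] := skew_derivation fb Bskew.
have [s sP] := wa delta dc dd.
apply: (diagonal_not_finite_rank _ Be); first by move=> p; rewrite expf_neq0 ?invr_eq0.
have [m [g [gl gP]]] := finite_rank_sum s (fun p => inner_finite_rank p.1 p.2 fb).
exists m, g; split=> // u gu v.
have yy : dotp y y != 0 by rewrite dotpp expf_neq0 ?normr_eq0.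
apply: (mulfI yy); rewrite mulr0 -dB sP.
rewrite blin_sumE.
under eq_bigr => p _ do rewrite inner_derivation_rank1.
by rewrite -mulr_sumr gP // mulr0.
Qed.
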